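(* Let $V_t(\mathbf{x})$, $t=0,\dots,T$, $\mathbf{x}\in\mathbb{N}^m$, be the value functions of the dynamic pricing Markov decision process described in the context. Fix a period $t\in\{0,\dots,T-1\}$, a state $\mathbf{x}\in\mathbb{N}^m$ and a booking type $i\in\{1,\dots,m\}$. A necessary condition for $r_i$ to be the optimal price for type $i$ at period $t$ and state $\mathbf{x}$, i.e. a maximizer of $r\mapsto m_t^i(1-F_t^i(r))\left(rQ_i-(V_{t+1}(\mathbf{x})-V_{t+1}(\mathbf{x}+\mathbf{e}_i))\right)$, is $$r_i=\frac{1-F_t^i(r_i)}{f_t^i(r_i)}+\frac{V_{t+1}(\mathbf{x})-V_{t+1}(\mathbf{x}+\mathbf{e}_i)}{Q_i}.$$ Moreover, if the function $r\mapsto (1-F_t^i(r))^2/f_t^i(r)$ is decreasing in $r$, then this equation has a unique solution, and this solution is the optimal price.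
   Context: There are $m$ booking types and periods $t=0,1,\dots,T-1$; departure is at $t=T$. A type $i$ booking has a random weight $W_i$ and a random volume $U_i$ with a given joint distribution. In period $t$ at most one booking request arrives; it is of type $i$ with probability $m_t^i>0$, where $\sum_{i}m_t^i\le 1$. The customer's reservation price for type $i$ in period $t$ has a differentiable cumulative distribution function $F_t^i$ with density $f_t^i=(F_t^i)'$. Prices range over $(0,\infty)$, and $f_t^i(r)>0$ there. Put $b_t^i(r)=m_t^i(1-F_t^i(r))$ and $Q_i=E[\max\{W_i,U_i/\gamma\}]>0$, where $\gamma>0$ is a constant. The state $\mathbf{x}=(x_1,\dots,x_m)\in\mathbb{N}^m$ (non-negative integers) records the numbers of accepted bookings of each type; $\mathbf{e}_i$ is the $i$-th unit vector. The value functions (assumed finite) are defined by $$V_t(\mathbf{x})=\sum_{i=1}^m\sup_{r_i}\left\{b_t^i(r_i)\left(r_iQ_i-(V_{t+1}(\mathbf{x})-V_{t+1}(\mathbf{x}+\mathbf{e}_i))\right)\right\}+V_{t+1}(\mathbf{x}),\quad t=0,\dots,T-1,$$ $$V_T(\mathbf{x})=-E\left[h_w\left(\left(\sum_{i=1}^m\sum_{j=1}^{x_i}W_{ij}-C_w\right)^+\right)+h_v\left(\left(\sum_{i=1}^m\sum_{j=1}^{x_i}U_{ij}-C_v\right)^+\right)\right],$$ where the $(W_{ij},U_{ij})$ are independent, $(W_{ij},U_{ij})$ is distributed as $(W_i,U_i)$, weights and volumes are non-negative, $C_w,C_v$ are the weight and volume capacities, $z^+=\max\{z,0\}$, and $h_w,h_v$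 are non-decreasing convex functions on $[0,\infty)$ with $h_w(0)=h_v(0)=0$.
   Formalization: Existence of the solution is claimed only if r(1-F(r)) tends to 0 as r tends to infinity (it can fail otherwise); that there is at most one solution, and that any solution is the optimal price, is proved without this. ''Decreasing'' means strictly decreasing; solutions are sought in (0,∞). *)

(* Defs.v *)
(* MathComp-Analysis; the reals are an arbitrary [R : realType]. *)
From HB Require Import structures.
From mathcomp Require Import all_boot all_order all_algebra.
From mathcomp Require Import all_classical all_reals all_analysis.

Set Implicit Arguments.
Unset Strict Implicit.
Unset Printing Implicit Defensive.

Import Order.TTheory GRing.Theory Num.Theory.
Import numFieldNormedType.Exports.

Local Open Scope classical_set_scope.
Local Open Scope ring_scope.

Section probability.
Context (R : realType) (d : measure_display) (Omega : measurableType d).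
Context (P : probability Omega R).

Definition mutually_independent (I : eqType) (d' : measure_display)
    (E : measurableType d') (X : I -> {RV P >-> E}) : Prop :=
  forall (s : seq I) (A : I -> set E), uniq s -> (forall k, measurable (A k)) ->
    P (\bigcap_(k in [set` s]) (X k @^-1` A k)) =
    (\prod_(k <- s) P (X k @^-1` A k))%E.

(* Equality on measurable sets only: the pushforward is a total function on
   all sets, whose values elsewhere carry no meaning. *)
Definition same_distribution (d' : measure_display) (E : measurableType d')
    (X Y : {RV P >-> E}) : Prop :=
  forall A : set E, measurable A -> distribution P X A = distribution P Y A.

Definition price_cdf (X : {RV P >-> R}) (r : R) : R := fine (cdf X r).

Definition price_pdf (X : {RV P >-> R}) : R -> R := derive1 (price_cdf X).

(* A booking is a random (weight, volume) pair. *)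
Definition chargeable_weight (gamma : R) (B : {RV P >-> (R * R)%type}) : \bar R :=
  ('E_P[fun w => Num.max (B w).1 ((B w).2 / gamma)%R])%E.

Definition mean_weight (gamma : R) (B : {RV P >-> (R * R)%type}) : R :=
  fine (chargeable_weight gamma B).

End probability.

Definition pos_part (R : realType) (z : R) : R := Num.max z 0.

Definition penalty_function (R : realType) (h : R -> R) : Prop :=
  [/\ {in `[0, +oo[ &, {homo h : y z / y <= z}},
      convex_function (E := R^o) `[0, +oo[ h &
      h 0 = 0].

Definition add_booking (m : nat) (x : 'I_m -> nat) (i : 'I_m) : 'I_m -> nat :=
  fun k => (x k + (k == i))%N.

Section pricing.
Context (R : realType) (d : measure_display) (Omega : measurableType d).
Context (P : probability Omega R) (m : nat).

Definition sale_prob (a : R) (X : {RV P >-> R}) (r : R) : R :=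
  a * (1 - price_cdf X r).

Definition opportunity_cost (V : nat -> ('I_m -> nat) -> R) (t : nat)
    (x : 'I_m -> nat) (i : 'I_m) : R :=
  V t x - V t (add_booking x i).

Definition price_objective (a : R) (X : {RV P >-> R}) (Q c r : R) : R :=
  sale_prob a X r * (r * Q - c).

Definition optimal_price (a : R) (X : {RV P >-> R}) (Q c r : R) : Prop :=
  0 < r /\ forall s : R, 0 < s ->
    price_objective a X Q c s <= price_objective a X Q c r.

(* [B i j] is the (j+1)-st accepted booking of type [i]. *)
Definition departure_cost (Cw Cv : R) (hw hv : R -> R)
    (B : 'I_m -> nat -> {RV P >-> (R * R)%type}) (x : 'I_m -> nat) : \bar R :=
  ('E_P[fun w =>
    (hw (pos_part ((\sum_(i < m) \sum_(j < x i) (B i j w).1) - Cw)) +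
    hv (pos_part ((\sum_(i < m) \sum_(j < x i) (B i j w).2) - Cv)))%R])%E.

(* The values are finite: [V] is real-valued, while the suprema and the
   expectation are taken in the extended reals, so that the equations force
   them to be finite. *)
Definition value_functions (T : nat) (a : nat -> 'I_m -> R)
    (X : nat -> 'I_m -> {RV P >-> R}) (Q : 'I_m -> R)
    (Cw Cv : R) (hw hv : R -> R)
    (B : 'I_m -> nat -> {RV P >-> (R * R)%type})
    (V : nat -> ('I_m -> nat) -> R) : Prop :=
  (forall x, (V T x)%:E = (- departure_cost Cw Cv hw hv B x)%E) /\
  (forall t x, (t < T)%N ->
    (V t x)%:E =
    (\sum_(i < m) ereal_sup
       [set (price_objective (a t i) (X t i) (Q i)
              (opportunity_cost V t.+1 x i) r)%:E | r in [set r : R | (0 < r)%R]]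
     + (V t.+1 x)%:E)%E).

End pricing.

(* Main.v *)
(* Write [G = 1 - F] and [N r = r - G r / f r]. The revenue has derivative
   [a Q f (c / Q - N r)], so an interior maximizer solves [N r = c / Q], and if
   [N] increases then a solution is unique and maximizes revenue. It does
   when [G^2 / f] decreases: the derivative of [1 / G] is
   [f / G^2], and [N r] is the Newton step for [1 / G] at [r]. A maximizer exists
   when [r G r] vanishes at infinity, because [c >= 0]: an additional booking
   never increases the value function. *)
Require Import Defs.
From HB Require Import structures.
From mathcomp Require Import all_boot all_order all_algebra.
From mathcomp Require Import all_classical all_reals all_analysis.
From mathcomp Require Import ring lra.

Set Implicit Arguments.
Unset Strict Implicit.
Unset Printing Implicit Defensive.

Import Order.TTheory GRing.Theory Num.Theory.
Import numFieldNormedType.Exports.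
Local Open Scope classical_set_scope.
Local Open Scope ring_scope.

(** * Mean values on the open half-line *)

Lemma MVT_pos (R : realType) (g dg : R -> R)
    (gdg : forall r : R, 0 < r -> is_derive r 1 g (dg r)) (r s : R) :
  0 < r -> r < s -> exists2 z, r < z < s & g s - g r = dg z * (s - r).
Proof.
move=> r0 rs.
have pos z : r <= z -> 0 < z by exact: lt_le_trans.
have [z|z|z] := @MVT R g dg r s rs.
- by rewrite in_itv /= => /andP[/ltW /pos z0 _]; exact: gdg.
- apply: derivable_within_continuous => y.
  by rewrite in_itv /= => /andP[/pos y0 _]; have [] := gdg _ y0.
by rewrite in_itv /= => zrs gE; exists z.
Qed.

Lemma derive_gt0_increasing (R : realType) (g dg : R -> R)
    (gdg : forall r : R, 0 < r -> is_derive r 1 g (dg r))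
    (dg_gt0 : forall r : R, 0 < r -> 0 < dg r) (r s : R) :
  0 < r -> r < s -> g r < g s.
Proof.
move=> r0 rs; have [z /andP[rz zs] gE] := MVT_pos gdg r0 rs.
rewrite -subr_gt0 gE mulr_gt0 ?subr_gt0//.
by apply: dg_gt0; exact: lt_trans rz.
Qed.

(** * Pricing of a single booking type *)

Section single_price.
Context (R : realType) (F f : R -> R) (a Q c : R).
Hypothesis a_gt0 : 0 < a.
Hypothesis Q_gt0 : 0 < Q.
Hypothesis F_derive : forall r : R, 0 < r -> is_derive r 1 F (f r).
Hypothesis f_gt0 : forall r : R, 0 < r -> 0 < f r.
Hypothesis F_ge0 : forall r : R, 0 <= F r.
Hypothesis F_le1 : forall r, F r <= 1.

Let revenue r := a * (1 - F r) * (r * Q - c).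
Let maximizer (r : R) := 0 < r /\ forall s : R, 0 < s -> revenue s <= revenue r.
Let solution (r : R) := 0 < r /\ r = (1 - F r) / f r + c / Q.

(** [F] still increases strictly after [r] and never exceeds [1]. *)
Lemma cdf_lt1 r : 0 < r -> F r < 1.
Proof.
move=> r0; apply: lt_le_trans (F_le1 (r + 1)).
by apply: derive_gt0_increasing r0 _ => //; rewrite ltrDl.
Qed.

(** The virtual valuation of auction theory; the pricing equation says that it equals [c / Q]. *)
Let virtual_price r := r - (1 - F r) / f r.

Lemma revenue_derive (r : R) : 0 < r ->
  is_derive r 1 revenue (a * Q * f r * (c / Q - virtual_price r)).
Proof.
move=> r0; have := F_derive r0 => dF.
have f_neq0 := lt0r_neq0 (f_gt0 r0); have Q_neq0 := lt0r_neq0 Q_gt0.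
rewrite /revenue; apply: is_derive_eq.
rewrite /virtual_price !scaler0 /= /GRing.scale /=.
by field; rewrite f_neq0 Q_neq0.
Qed.

Lemma maximizer_solution r : maximizer r -> solution r.
Proof.
move=> [r0 rmax]; split=> //.
have : is_derive r 1 revenue 0.
  (* The bound [r + 1] only serves to make [r] interior. *)
  apply: (@derive1_at_max _ _ 0 (r + 1)).
  - lra.
  - by move=> s; rewrite in_itv /= => /andP[s0 _]; have [] := revenue_derive s0.
  - rewrite in_itv /=; lra.
  - by move=> s; rewrite in_itv /= => /andP[s0 _]; exact: rmax.
move=> [_ D0]; have [_] := revenue_derive r0; rewrite D0 => /esym/eqP.
by rewrite mulf_eq0 gt_eqF ?mulr_gt0 ?f_gt0//= subr_eq0 /virtual_price => /eqP; lra.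
Qed.

Section decreasing.
Hypothesis H_decreasing : forall r s : R, 0 < r -> r < s ->
  (1 - F s) ^+ 2 / f s < (1 - F r) ^+ 2 / f r.

(* With [K = 1 / (1 - F)], the hypothesis says that [K' = f / (1 - F)^2]
   increases, and [virtual_price r = r - K r / K' r] is the Newton step for [K]
   at [r]; the Newton step of a positive strictly convex function increases. *)
Lemma virtual_price_increasing r s : 0 < r -> r < s ->
  virtual_price r < virtual_price s.
Proof.
move=> r0 rs; have s0 := lt_trans r0 rs.
pose K (z : R) := (1 - F z)^-1; pose dK (z : R) := f z / (1 - F z) ^+ 2.
have G_gt0 z : 0 < z -> 0 < 1 - F z by move=> /cdf_lt1; rewrite subr_gt0.
have K_gt0 z : 0 < z -> 0 < K z by move=> /G_gt0; rewrite invr_gt0.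
have dK_gt0 (z : R) : 0 < z -> 0 < dK z.
  by move=> z0; rewrite divr_gt0 ?f_gt0 ?exprn_gt0 ?G_gt0.
have K_derive (z : R) : 0 < z -> is_derive z 1 K (dK z).
  move=> z0; have dF := F_derive z0; have G_neq0 := lt0r_neq0 (G_gt0 _ z0).
  have dG : is_derive z 1 (fun y => 1 - F y) (0 - f z) by exact: is_deriveB.
  apply: is_derive_eq (@is_deriveV _ (fun y => 1 - F y) _ _ _ G_neq0 dG) _.
  by rewrite /dK /GRing.scale /=; field.
have dK_increasing y z : 0 < y -> y < z -> dK y < dK z.
  move=> y0 yz; have z0 := lt_trans y0 yz.
  rewrite -ltf_pV2 ?posrE ?dK_gt0//.
  by rewrite /dK !invf_div; exact: H_decreasing.
have virtual_priceE z : 0 < z -> virtual_price z = z - K z / dK z.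
  move=> z0; rewrite /virtual_price /K /dK; congr (_ - _).
  have := lt0r_neq0 (G_gt0 _ z0); have := lt0r_neq0 (f_gt0 z0) => f0 G0.
  by field; rewrite f0 G0.
rewrite !virtual_priceE//.
(* The quotient [K r / dK s] mediates: the mean value theorem gives [(K s - K r) / dK s < s - r],
   and [K r / dK s < K r / dK r] since [K r] is positive. *)
have [z /andP[rz zs] KE] := MVT_pos K_derive r0 rs.
have Krs : K s - K r < dK s * (s - r).
  by rewrite KE ltr_pM2r ?subr_gt0//; apply: dK_increasing (lt_trans r0 rz) zs.
have Kr : K r / dK s < K r / dK r.
  by rewrite ltr_pM2l ?K_gt0// ltf_pV2 ?posrE ?dK_gt0// dK_increasing.
have : (K s - K r) / dK s < s - r by rewrite ltr_pdivrMr ?dK_gt0// mulrC.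
rewrite mulrBl; lra.
Qed.

Lemma solution_unique r s : solution r -> solution s -> r = s.
Proof.
move=> [r0 rE] [s0 sE].
have vE : virtual_price r = virtual_price s by rewrite /virtual_price; lra.
by case: (ltgtP r s) => // [/(virtual_price_increasing r0)
  |/(virtual_price_increasing s0)]; rewrite vE ltxx.
Qed.

(** The derivative of [revenue] at [z] has the sign of [virtual_price r - virtual_price z], so
    [revenue] rises up to [r] and falls after it. *)
Lemma solution_maximizer r : solution r -> maximizer r.
Proof.
move=> [r0 rE]; split=> // s s0.
have vr : c / Q = virtual_price r by rewrite /virtual_price; lra.
have aQf z : 0 < z -> 0 <= a * Q * f z.
  by move=> z0; rewrite ltW// !mulr_gt0 ?f_gt0.
case: (ltgtP r s) => [rs|sr|->//].
- have [z /andP[rz zs]] := MVT_pos revenue_derive r0 rs.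
  have z0 := lt_trans r0 rz; move/eqP; rewrite subr_eq => /eqP ->.
  rewrite gerDr vr mulr_le0_ge0 ?subr_ge0 ?(ltW rs)//.
  by rewrite mulr_ge0_le0 ?aQf// subr_le0 ltW// virtual_price_increasing.
- have [z /andP[sz zr]] := MVT_pos revenue_derive s0 sr.
  have z0 := lt_trans s0 sz; rewrite -subr_ge0 => ->.
  rewrite vr mulr_ge0 ?subr_ge0 ?(ltW sr)// mulr_ge0 ?aQf// subr_ge0 ltW//.
  exact: virtual_price_increasing.
Qed.
End decreasing.

(* Since [0 <= c], revenue is small near [c / Q] and negative below it, so
   that a revenue maximum cannot escape to the boundary at [0]. *)
Lemma maximizer_exists : 0 <= c ->
  r * (1 - F r) @[r --> +oo] --> (0 : R) -> exists r, maximizer r.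
Proof.
move=> c0 rG0; pose k := c / Q.
have k0 : 0 <= k by rewrite divr_ge0// ltW.
pose psi (r : R) := (1 - F r) * (r - k).
have revenueE r : revenue r = a * Q * psi r.
  by rewrite /revenue /psi /k; have := lt0r_neq0 Q_gt0 => Q_neq0; field.
have G_ge0 r : 0 <= 1 - F r by rewrite subr_ge0.
have G_le1 r : 1 - F r <= 1 by rewrite gerBl.
(* The price [k + 1] is the benchmark: prices up to [k + v / 2] or beyond [M] earn less, so a
   maximum over the compact interval between them is global. The bound [v <= 1] places [k + 1] in
   that interval. *)
pose v := psi (k + 1).
have v0 : 0 < v by rewrite /v /psi addrAC subrr add0r mulr1 subr_gt0 cdf_lt1; lra.
have v1 : v <= 1 by rewrite /v /psi addrAC subrr add0r mulr1.
have psi_le_rG r : psi r <= r * (1 - F r).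
  by rewrite /psi mulrC ler_wpM2r//; lra.
have [M [M1 psiM]] : exists M, k + 1 < M /\ forall r, M < r -> psi r < v.
  have [N [_ NP]] : \forall r \near +oo, r * (1 - F r) < v.
    exact: (cvgr_lt _ rG0).
  exists (Num.max (k + 2) N); split; first by rewrite lt_max; apply/orP; left; lra.
  by move=> r; rewrite gt_max => /andP[_ /NP]; exact: le_lt_trans.
(* [psi] is non-positive up to [k], and at most [r - k <= v / 2] after it. *)
have psi_small r : r <= k + v / 2 -> psi r < v.
  move=> rk; have [rk0|kr] := leP r k.
    by apply: le_lt_trans v0; rewrite /psi mulr_ge0_le0// subr_le0.
  have : psi r <= r - k by rewrite /psi ler_piMl// subr_ge0 ltW.
  lra.
have [||p] := @EVT_max R psi (k + v / 2) M; first lra.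
  apply: derivable_within_continuous => y; rewrite in_itv /= => /andP[ky _].
  have y0 : 0 < y by lra.
  by have dF := F_derive y0; apply: ex_derive.
rewrite in_itv /= => /andP[kp pM] pmax.
have vp : v <= psi p by apply: pmax; rewrite in_itv /=; lra.
exists p; split; first lra.
move=> s s0; rewrite !revenueE ler_pM2l ?mulr_gt0//.
have [/psi_small|ks] := leP s (k + v / 2); first lra.
have [sM|/psiM] := leP s M; last lra.
by apply: pmax; rewrite in_itv /= sM ltW.
Qed.

End single_price.

(** * Monotonicity of costs and values in the bookings *)

Lemma ge0_le_expectation d (Omega : measurableType d) (R : realType)
    (P : probability Omega R) (X Y : Omega -> R) :
  (forall w, 0 <= X w) -> (forall w, X w <= Y w) -> ('E_P[X] <= 'E_P[Y])%E.
Proof.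
move=> X0 XY; rewrite unlock !ge0_integralTE; last 2 first.
- by move=> w; rewrite lee_fin (le_trans (X0 w)).
- by move=> w; rewrite lee_fin.
apply: le_ereal_sup => _ [h hX <-]; exists h => // w.
by apply: le_trans (hX w) _; rewrite lee_fin.
Qed.

Lemma sum_ord_le (R : numDomainType) (u : nat -> R) (p q : nat) :
  (forall j, 0 <= u j) -> (p <= q)%N -> \sum_(j < p) u j <= \sum_(j < q) u j.
Proof.
move=> u0 pq; rewrite -!(big_mkord predT) [leRHS](big_cat_nat (leq0n p) pq)/=.
by rewrite lerDl sumr_ge0.
Qed.

Section value_functions.
Context (R : realType) (d : measure_display) (Omega : measurableType d).
Context (P : probability Omega R) (m : nat).

(** Outcome by outcome, more bookings bring at least as much weight and volume, and the penalties
    are monotone. *)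
Lemma departure_cost_le (Cw Cv : R) (hw hv : R -> R)
    (B : 'I_m -> nat -> {RV P >-> (R * R)%type}) (x y : 'I_m -> nat) :
  penalty_function hw -> penalty_function hv ->
  (forall i j w, 0 <= (B i j w).1 /\ 0 <= (B i j w).2) ->
  (forall i, (x i <= y i)%N) ->
  (departure_cost Cw Cv hw hv B x <= departure_cost Cw Cv hw hv B y)%E.
Proof.
move=> [hw_homo _ hw0] [hv_homo _ hv0] B0 xy.
have pp (z : R) : 0 <= pos_part z by rewrite /pos_part le_max lexx orbT.
have h_ge0 (h : R -> R) z : {in `[0, +oo[ &, {homo h : y z / y <= z}} ->
    h 0 = 0 -> 0 <= h (pos_part z).
  by move=> h_homo <-; apply: h_homo; rewrite ?in_itv /= ?pp ?lexx.
have h_le (h : R -> R) C u v : {in `[0, +oo[ &, {homo h : y z / y <= z}} ->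
    u <= v -> h (pos_part (u - C)) <= h (pos_part (v - C)).
  move=> h_homo uv; apply: h_homo; rewrite ?in_itv /= ?pp//.
  by rewrite /pos_part ge_max !le_max lexx lerB// orbT.
rewrite /departure_cost; apply: ge0_le_expectation => w.
  by rewrite addr_ge0// h_ge0.
rewrite lerD// h_le//; apply: ler_sum => i _.
  by apply: (sum_ord_le (u := fun j => (B i j w).1)) => // j; have [] := B0 i j w.
by apply: (sum_ord_le (u := fun j => (B i j w).2)) => // j; have [] := B0 i j w.
Qed.

Lemma price_cdf_ge0 (X : {RV P >-> R}) r : 0 <= price_cdf X r.
Proof. exact/fine_ge0/cdf_ge0. Qed.

Lemma price_cdf_le1 (X : {RV P >-> R}) r : price_cdf X r <= 1.
Proof.
rewrite -lee_fin /price_cdf fineK ?cdf_le1//.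
by rewrite ge0_fin_numE ?cdf_ge0// (le_lt_trans (cdf_le1 _ _))// ltry.
Qed.

Lemma add_bookingC (x : 'I_m -> nat) i j :
  add_booking (add_booking x i) j = add_booking (add_booking x j) i.
Proof. by apply/funext => k; rewrite /add_booking addnAC. Qed.

(* Any prices earn, from one more booking, at most what they earn without it
   plus the value lost by that booking times the probability of a sale; these
   probabilities sum to at most [1]. *)
Lemma value_nonincreasing (T : nat) (a : nat -> 'I_m -> R)
    (X : nat -> 'I_m -> {RV P >-> R}) (Q : 'I_m -> R)
    (Cw Cv : R) (hw hv : R -> R)
    (B : 'I_m -> nat -> {RV P >-> (R * R)%type})
    (V : nat -> ('I_m -> nat) -> R) :
  (forall t i, (t < T)%N -> 0 < a t i) ->
  (forall t, (t < T)%N -> \sum_(i < m) a t i <= 1) ->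
  (forall i j w, 0 <= (B i j w).1 /\ 0 <= (B i j w).2) ->
  penalty_function hw -> penalty_function hv ->
  value_functions T a X Q Cw Cv hw hv B V ->
  forall t x i, (t <= T)%N -> V t (add_booking x i) <= V t x.
Proof.
move=> a_gt0 a_sum B0 hwP hvP [VT Vt] t x i tT.
(* Backward induction, on the number [T - t] of remaining periods. *)
rewrite -(subKn tT); have := leq_subr t T.
elim: (T - t)%N x i => [|n IHn] x i nT.
  rewrite subn0 -lee_fin !VT leeN2; apply: departure_cost_le => // k.
  exact: leq_addr.
set s := (T - n.+1)%N.
have sT : (s < T)%N by rewrite /s subnSK// leq_subr.
have {IHn}IHs y k : V s.+1 (add_booking y k) <= V s.+1 y.
  by rewrite /s subnSK//; apply: IHn; exact: ltnW.
rewrite -lee_fin !(Vt s _ sT); set y := add_booking x i.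
pose D := V s.+1 x - V s.+1 y.
have D0 : 0 <= D by rewrite subr_ge0 IHs.
(* Type [k] contributes at [y] at most its supremum at [x] plus [a s k * D]. *)
apply: (@le_trans _ _ (\sum_(k < m) (ereal_sup
    [set (price_objective (a s k) (X s k) (Q k)
      (opportunity_cost V s.+1 x k) r)%:E | r in [set r : R | (0 < r)%R]] +
    (a s k * D)%:E) + (V s.+1 y)%:E)%E).
  apply/leeD2r/lee_sum => k _; apply: ge_ereal_sup => _ [r r0 <-].
  apply: (@le_trans _ _ ((price_objective (a s k) (X s k) (Q k)
      (opportunity_cost V s.+1 x k) r)%:E + (a s k * D)%:E)%E); last first.
    by apply/leeD2r/ereal_sup_ubound; exists r.
  rewrite -EFinD lee_fin /price_objective.
  have b_ge0 : 0 <= sale_prob (a s k) (X s k) r.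
    by rewrite mulr_ge0 ?subr_ge0 ?price_cdf_le1// ltW// a_gt0.
  have b_le : sale_prob (a s k) (X s k) r <= a s k.
    by rewrite ler_piMr ?gerBl ?price_cdf_ge0// ltW// a_gt0.
  apply: le_trans (lerD (lexx _) (ler_wpM2r D0 b_le)).
  (* With the sale probability factored out, it remains that a booking of type [i] does not raise
     the value after a sale of type [k]. *)
  rewrite -mulrDr ler_wpM2l// /D /opportunity_cost.
  have := IHs (add_booking x k) i; rewrite add_bookingC -/y; lra.
(* The added terms total at most [D], which is exactly the gap between [V s.+1 x] and [V s.+1 y]. *)
rewrite big_split /= -addeA sumEFin -mulr_suml -EFinD; apply: leeD2l.
rewrite lee_fin -lerBrDr -/D ler_piMl// a_sum//.
Qed.

End value_functions.

Theorem theorem1 (R : realType) (d : measure_display) (Omega : measurableType d)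
  (P : probability Omega R) (m T : nat)
  (a : nat -> 'I_m -> R)
  (X : nat -> 'I_m -> {RV P >-> R})
  (gamma Cw Cv : R) (hw hv : R -> R)
  (WU : 'I_m -> {RV P >-> (R * R)%type})
  (B : 'I_m -> nat -> {RV P >-> (R * R)%type})
  (V : nat -> ('I_m -> nat) -> R)
  (a_gt0 : forall t i, (t < T)%N -> 0 < a t i)
  (a_sum : forall t, (t < T)%N -> \sum_(i < m) a t i <= 1)
  (F_derivable : forall t i (r : R), (t < T)%N -> 0 < r ->
    derivable (price_cdf (X t i)) r 1)
  (f_gt0 : forall t i (r : R), (t < T)%N -> 0 < r -> 0 < price_pdf (X t i) r)
  (gamma_gt0 : 0 < gamma)
  (Q_gt0 : forall i, (0 < chargeable_weight gamma (WU i) < +oo)%E)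
  (WU_ge0 : forall i w, 0 <= (WU i w).1 /\ 0 <= (WU i w).2)
  (B_ge0 : forall i j w, 0 <= (B i j w).1 /\ 0 <= (B i j w).2)
  (B_indep : mutually_independent (fun k : 'I_m * nat => B k.1 k.2))
  (B_distr : forall i j, same_distribution (B i j) (WU i))
  (hw_penalty : penalty_function hw)
  (hv_penalty : penalty_function hv)
  (V_value : value_functions T a X (fun i => mean_weight gamma (WU i))
    Cw Cv hw hv B V)
  (t : nat) (x : 'I_m -> nat) (i : 'I_m) (t_lt : (t < T)%N) :
  let F := price_cdf (X t i) in
  let f := price_pdf (X t i) in
  let Q := mean_weight gamma (WU i) in
  let c := opportunity_cost V t.+1 x i in
  let solution r := 0 < r /\ r = (1 - F r) / f r + c / Q in
  let optimal := optimal_price (a t i) (X t i) Q c in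
  (forall r : R, optimal r -> r = (1 - F r) / f r + c / Q) /\
  ({in `]0, +oo[ &, forall r s : R,
      r < s -> (1 - F s) ^+ 2 / f s < (1 - F r) ^+ 2 / f r} ->
   [/\ (* the equation has at most one solution *)
       forall r s : R, solution r -> solution s -> r = s,
       (* a solution is the optimal price *)
       forall r : R, solution r -> optimal r &
       (* the unique solution exists when r * P(X > r) vanishes at infinity *)
       r * (1 - F r) @[r --> +oo] --> (0 : R) ->
         exists! r : R, solution r]).
Proof.
move=> F f Q c solution optimal.
(* Finiteness of the expectation matters here: [fine] maps [+oo] to [0]. *)
have Q0 : 0 < Q by exact/fine_gt0/Q_gt0.
have a0 := a_gt0 t i t_lt.
have dF (r : R) : 0 < r -> is_derive r 1 F (f r).
  by move=> r0; rewrite /f /price_pdf derive1E; exact/derivableP/F_derivable.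
have f0 (r : R) : 0 < r -> 0 < f r by exact: f_gt0.
have F0 := price_cdf_ge0 (X t i); have F1 := price_cdf_le1 (X t i).
have optimal_solution r : optimal r -> solution r.
  exact: (maximizer_solution a0 Q0 dF f0).
split=> [r /optimal_solution[]//|H].
have H_decreasing (r s : R) : 0 < r -> r < s ->
    (1 - F s) ^+ 2 / f s < (1 - F r) ^+ 2 / f r.
  move=> r0 rs; apply: H => //; rewrite in_itv /= andbT//.
  exact: lt_trans rs.
have unique r s : solution r -> solution s -> r = s.
  exact: (solution_unique dF f0 F1 H_decreasing).
split=> // [r|rG0].
  exact: (solution_maximizer a0 Q0 dF f0 F1 H_decreasing).
have c0 : 0 <= c.
  rewrite subr_ge0.
  exact: (value_nonincreasing a_gt0 a_sum B_ge0 hw_penalty hv_penalty V_value).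
(* The solution is obtained as a revenue maximizer, through the first-order condition. *)
have [r /optimal_solution rP] := maximizer_exists a0 Q0 dF f0 F0 F1 c0 rG0.
by exists r; split=> // s; exact: unique.
Qed.
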